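(* Let $(b_n)_{n\ge 0}$ and $(e_n)_{n\ge 0}$ be sequences of real numbers satisfying: (1) $b_n>0$ for all sufficiently large $n$; (2) there is a constant $C$ such that $\displaystyle \frac{\sum_{k=0}^{2n} b_k}{\sum_{k=0}^{n} b_k}<C$ for all sufficiently large $n$; (3) $\displaystyle\limsup_{n\to\infty} b_n<1$; (4) $\displaystyle\lim_{n\to\infty}\frac{\left(\sum_{k=0}^n b_k^2\right)\left(\sum_{k=0}^n e_k^2\right)}{\left(\sum_{k=0}^n b_k\right)^3}=0$. Then there is no set $A\subseteq\mathbb{N}$ such that for every $N\ge 0$ $$\sum_{n=0}^N R_A(n)=\sum_{n=0}^N\sum_{k=0}^n b_kb_{n-k}+e_N .$$
   Context: $\mathbb{N}$ denotes the set of non-negative integers. For $A\subseteq\mathbb{N}$, $R_A(n)$ denotes the number of ordered pairs $(a,a')$ with $a,a'\in A$ and $a+a'=n$; equivalently $R_A(n)=\sum_{k=0}^n\chi_A(k)\chi_A(n-k)$ where $\chi_A$ is the characteristic function of $A$. *)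

(* Defs.v *)
From Stdlib Require Import Reals.
From Coquelicot Require Import Coquelicot.
Open Scope R_scope.

Definition chi (A : nat -> bool) (k : nat) : R := if A k then 1 else 0.

Definition RA (A : nat -> bool) (n : nat) : R :=
  sum_f_R0 (fun k => chi A k * chi A (n - k)%nat) n.

Definition psum (u : nat -> R) (n : nat) : R := sum_f_R0 u n.

Definition conv (b : nat -> R) (n : nat) : R :=
  sum_f_R0 (fun k => b k * b (n - k)%nat) n.

(* Main.v *)
(** If [A] existed, the generating functions of [chi A], [b] and [e] would satisfy
    [A(u)^2 = B(u)^2 + (1 - u) E(u)].

    When [psum b] is unbounded, one follows Erdos and Fuchs: multiply by [|P(u)|^2] with
    [P = 1 + u + ... + u^(M-1)] and average over the circle [|u|^2 = x < 1]. By Parseval, and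
    because the coefficients of [P A] are integers, the left side is at least [A(x)] times
    [P(x)], while the right side is at most [M P(x) sum b_n^2 x^n] plus an error controlled by
    [sum e_n^2 x^n]. Taking [M] about [kappa B(x) / sum b_n^2 x^n] makes the right side smaller
    than [P(x) B(x)], hence than the left side, since [A(x) ~ B(x)]. The doubling hypothesis
    transfers the smallness of the error from partial sums to power series. All series are
    truncated at a high degree [T], so that the average over the circle becomes an average over
    roots of unity.

    When [psum b] is bounded, the hypotheses force [e = 0], so [A^2 = B^2] and [b = chi A] or
    [b = - chi A], against [0 < b n < 1] for large [n]. *)

Require Import Defs.
From Stdlib Require Import Reals ZArith Lra Lia Classical FunctionalExtensionality.
From Coquelicot Require Import Coquelicot.
Open Scope R_scope.

(** Sums run over the half-open range [k < n], so that ranges concatenate and the empty sum exists;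
    [sum_f_R0] includes its endpoint. *)
Fixpoint rsum (f : nat -> R) (n : nat) : R :=
  match n with O => 0 | S m => rsum f m + f m end.

Fixpoint csum (f : nat -> C) (n : nat) : C :=
  match n with O => RtoC 0 | S m => (csum f m + f m)%C end.

Definition peval (f : nat -> R) (T : nat) (u : C) : C :=
  csum (fun n => (RtoC (f n) * u ^ n)%C) T.

Definition rpeval (f : nat -> R) (T : nat) (x : R) : R :=
  rsum (fun n => f n * x ^ n) T.

(** * Finite sums *)

Lemma rsum_ext (f g : nat -> R) n :
  (forall k, (k < n)%nat -> f k = g k) -> rsum f n = rsum g n.
Proof.
  induction n as [|n IH]; simpl; intros H; [reflexivity|].
  rewrite IH by (intros; apply H; lia). rewrite H by lia. reflexivity.
Qed.

Lemma csum_ext (f g : nat -> C) n :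
  (forall k, (k < n)%nat -> f k = g k) -> csum f n = csum g n.
Proof.
  induction n as [|n IH]; simpl; intros H; [reflexivity|].
  rewrite IH by (intros; apply H; lia). rewrite H by lia. reflexivity.
Qed.

Lemma rsum_le (f g : nat -> R) n :
  (forall k, (k < n)%nat -> f k <= g k) -> rsum f n <= rsum g n.
Proof.
  induction n as [|n IH]; simpl; intros H; [lra|].
  specialize (IH (fun k hk => H k (Nat.lt_lt_succ_r _ _ hk))).
  specialize (H n (Nat.lt_succ_diag_r n)). lra.
Qed.

Lemma rsum_ge_0 (f : nat -> R) n :
  (forall k, (k < n)%nat -> 0 <= f k) -> 0 <= rsum f n.
Proof.
  induction n as [|n IH]; simpl; intros H; [lra|].
  specialize (IH (fun k hk => H k (Nat.lt_lt_succ_r _ _ hk))).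
  specialize (H n (Nat.lt_succ_diag_r n)). lra.
Qed.

Lemma rsum_plus (f g : nat -> R) n :
  rsum (fun k => f k + g k) n = rsum f n + rsum g n.
Proof. induction n as [|n IH]; simpl; [|rewrite IH]; ring. Qed.

Lemma rsum_scal (c : R) (f : nat -> R) n :
  rsum (fun k => c * f k) n = c * rsum f n.
Proof. induction n as [|n IH]; simpl; [|rewrite IH]; ring. Qed.

Lemma rsum_const (c : R) n : rsum (fun _ => c) n = INR n * c.
Proof.
  induction n as [|n IH]; [simpl; ring|].
  rewrite S_INR. simpl. rewrite IH. ring.
Qed.

Lemma rsum_exchange (F : nat -> nat -> R) m n :
  rsum (fun i => rsum (F i) n) m = rsum (fun j => rsum (fun i => F i j) m) n.
Proof.
  induction m as [|m IH]; simpl.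
  - rewrite rsum_const. ring.
  - rewrite IH, rsum_plus. reflexivity.
Qed.

Lemma rsum_add (f : nat -> R) m n :
  rsum f (m + n) = rsum f m + rsum (fun k => f (m + k)%nat) n.
Proof.
  induction n as [|n IH]; simpl.
  - rewrite Nat.add_0_r. ring.
  - rewrite Nat.add_succ_r. simpl. rewrite IH. ring.
Qed.

Lemma csum_add (f : nat -> C) m n :
  csum f (m + n) = (csum f m + csum (fun k => f (m + k)%nat) n)%C.
Proof.
  induction n as [|n IH]; simpl.
  - rewrite Nat.add_0_r. ring.
  - rewrite Nat.add_succ_r. simpl. rewrite IH. ring.
Qed.

Lemma csum_plus (f g : nat -> C) n :
  csum (fun k => (f k + g k)%C) n = (csum f n + csum g n)%C.
Proof. induction n as [|n IH]; simpl; [|rewrite IH]; ring. Qed.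

Lemma csum_scal (c : C) (f : nat -> C) n :
  csum (fun k => (c * f k)%C) n = (c * csum f n)%C.
Proof. induction n as [|n IH]; simpl; [|rewrite IH]; ring. Qed.

Lemma rsum_monotone (f : nat -> R) m n :
  (m <= n)%nat -> (forall k, (m <= k)%nat -> 0 <= f k) -> rsum f m <= rsum f n.
Proof.
  intros Hmn Hf. replace n with (m + (n - m))%nat by lia.
  rewrite rsum_add.
  assert (0 <= rsum (fun k => f (m + k)%nat) (n - m))
    by (apply rsum_ge_0; intros; apply Hf; lia).
  lra.
Qed.

Lemma csum_Cmod_le (f : nat -> C) n :
  Cmod (csum f n) <= rsum (fun k => Cmod (f k)) n.
Proof.
  induction n as [|n IH]; simpl.
  - rewrite Cmod_0. lra.
  - eapply Rle_trans; [apply Cmod_triangle|]. lra.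
Qed.

Lemma psum_rsum (f : nat -> R) n : psum f n = rsum f (S n).
Proof.
  unfold psum. induction n as [|n IH]; simpl in *; [ring|].
  rewrite IH. reflexivity.
Qed.

Lemma rsum_abs_le (f : nat -> R) n :
  Rabs (rsum f n) <= rsum (fun k => Rabs (f k)) n.
Proof.
  induction n as [|n IH]; simpl.
  - rewrite Rabs_R0. lra.
  - eapply Rle_trans; [apply Rabs_triang|]. lra.
Qed.

(** By induction: the new cross term [2 X s t] is at most [F t ^ 2 + G s ^ 2], because
    [X ^ 2 <= F G] and by the arithmetic-geometric mean inequality. *)
Lemma rsum_cauchy_schwarz (f g : nat -> R) n :
  rsum (fun k => f k * g k) n ^ 2
  <= rsum (fun k => f k ^ 2) n * rsum (fun k => g k ^ 2) n.
Proof.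
  induction n as [|n IH]; [simpl; lra|].
  cbn [rsum].
  assert (HF : 0 <= rsum (fun k => f k ^ 2) n)
    by (apply rsum_ge_0; intros; apply pow2_ge_0).
  assert (HG : 0 <= rsum (fun k => g k ^ 2) n)
    by (apply rsum_ge_0; intros; apply pow2_ge_0).
  revert IH HF HG.
  generalize (rsum (fun k => f k * g k) n) as X.
  generalize (rsum (fun k => f k ^ 2) n) as F.
  generalize (rsum (fun k => g k ^ 2) n) as G.
  generalize (f n) as s. generalize (g n) as t.
  intros t s G F X IH HF HG.
  assert (H : (2 * X * (s * t)) ^ 2 <= (F * t ^ 2 + G * s ^ 2) ^ 2).
  { assert (0 <= (F * t ^ 2 - G * s ^ 2) ^ 2) by apply pow2_ge_0.
    assert (0 <= (F * G - X ^ 2) * (s * t) ^ 2)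
      by (apply Rmult_le_pos; [lra | apply pow2_ge_0]).
    nra. }
  assert (0 <= F * t ^ 2 + G * s ^ 2).
  { assert (0 <= t ^ 2) by apply pow2_ge_0.
    assert (0 <= s ^ 2) by apply pow2_ge_0. nra. }
  assert (2 * X * (s * t) <= F * t ^ 2 + G * s ^ 2)
    by (apply Rsqr_incr_0_var; [unfold Rsqr; nra | assumption]).
  nra.
Qed.

(** * Evaluation of truncated power series *)

Lemma peval_RtoC (f : nat -> R) T (x : R) :
  peval f T (RtoC x) = RtoC (rpeval f T x).
Proof.
  unfold peval, rpeval. induction T as [|T IH]; simpl; [reflexivity|].
  rewrite IH, RtoC_plus, RtoC_mult, RtoC_pow. reflexivity.
Qed.

Lemma peval_bound (f : nat -> R) T (u : C) :
  Cmod (peval f T u) <= rsum (fun n => Rabs (f n) * Cmod u ^ n) T.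
Proof.
  unfold peval. eapply Rle_trans; [apply csum_Cmod_le|].
  right. apply rsum_ext. intros k _. rewrite Cmod_mult, Cmod_R, Cmod_pow. reflexivity.
Qed.

Lemma geometric_sum (u : C) M :
  ((1 - u) * peval (fun _ => 1) M u = 1 - u ^ M)%C.
Proof.
  unfold peval. induction M as [|M IH].
  - simpl. ring.
  - cbn [csum]. rewrite Cmult_plus_distr_l, IH, Cpow_S. ring.
Qed.

Lemma geometric_rsum (x : R) M : (1 - x) * rpeval (fun _ => 1) M x = 1 - x ^ M.
Proof.
  unfold rpeval. induction M as [|M IH].
  - simpl. ring.
  - cbn [rsum]. rewrite Rmult_plus_distr_l, IH. simpl. ring.
Qed.

(** * Parseval's identity on the roots of unity *)

(** The point [r exp(2 pi i j / L)], that is, an [L]-th root of unity scaled to the circle of radius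
    [r]. *)
Definition root_of_unity (r : R) (L j : nat) : C :=
  (r * cos (2 * PI * INR j / INR L), r * sin (2 * PI * INR j / INR L)).

Lemma polar_pow (r t : R) n :
  Cpow (r * cos t, r * sin t) n = (r ^ n * cos (INR n * t), r ^ n * sin (INR n * t)).
Proof.
  induction n as [|n IH].
  - simpl. rewrite Rmult_0_l, cos_0, sin_0. unfold RtoC. f_equal; ring.
  - rewrite Cpow_S, IH, S_INR, Rmult_plus_distr_r, Rmult_1_l, cos_plus, sin_plus.
    unfold Cmult; cbn [fst snd pow]. f_equal; ring.
Qed.

Lemma Cmod_root_of_unity r L j : 0 <= r -> Cmod (root_of_unity r L j) = r.
Proof.
  intros Hr. unfold root_of_unity, Cmod; simpl.
  set (t := 2 * PI * INR j / INR L).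
  replace (_ + _) with (r * r).
  - apply sqrt_square; assumption.
  - pose proof (sin2_cos2 t) as H. unfold Rsqr in H.
    replace (r * r) with (r * r * (sin t * sin t + cos t * cos t)) by (rewrite H; ring).
    ring.
Qed.

(** Multiplied by [2 sin h] with [h = k pi / L], the sum telescopes. The end term has argument
    [2 k pi - h] and cancels [sin h], which is nonzero as [0 < h < pi]. *)
Lemma sum_cos_roots_of_unity (L k : nat) :
  (0 < k < L)%nat ->
  rsum (fun j => cos (INR k * (2 * PI * INR j / INR L))) L = 0.
Proof.
  intros Hk.
  assert (HL : 0 < INR L) by (apply lt_0_INR; lia).
  set (h := INR k * PI / INR L).
  assert (Htel : forall n,
    2 * sin h * rsum (fun j => cos (INR k * (2 * PI * INR j / INR L))) n
    = sin (h * (2 * INR n - 1)) + sin h).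
  { intros n. induction n as [|n IH].
    - simpl. replace (h * (2 * 0 - 1)) with (- h) by ring. rewrite sin_neg. ring.
    - cbn [rsum]. rewrite Rmult_plus_distr_l, IH, S_INR.
      replace (INR k * (2 * PI * INR n / INR L)) with (2 * h * INR n)
        by (unfold h; field; lra).
      replace (h * (2 * (INR n + 1) - 1)) with (2 * h * INR n + h) by ring.
      replace (h * (2 * INR n - 1)) with (2 * h * INR n - h) by ring.
      rewrite sin_plus, sin_minus. ring. }
  specialize (Htel L).
  replace (h * (2 * INR L - 1)) with (- h + 2 * INR k * PI) in Htel
    by (unfold h; field; lra).
  rewrite sin_period, sin_neg in Htel.
  assert (0 < sin h).
  { pose proof PI_RGT_0.
    assert (0 < INR k < INR L) by (split; [apply lt_0_INR | apply lt_INR]; lia).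
    assert (Hq : 0 < INR k / INR L < 1).
    { split; [apply Rdiv_lt_0_compat; lra|].
      apply Rmult_lt_reg_r with (INR L); [lra|]. field_simplify; lra. }
    apply sin_gt_0; unfold h; replace (INR k * PI / INR L) with (INR k / INR L * PI)
      by (field; lra); nra. }
  nra.
Qed.

(** Induction on [K]: the new frequency contributes cross terms [cos ((K - n) t)], and these average
    to zero because [0 < K - n < L]. *)
Lemma parseval_trig (w : nat -> R) (L K : nat) : (K <= L)%nat ->
  rsum (fun j => rsum (fun n => w n * cos (INR n * (2 * PI * INR j / INR L))) K ^ 2
               + rsum (fun n => w n * sin (INR n * (2 * PI * INR j / INR L))) K ^ 2) L
  = INR L * rsum (fun n => w n ^ 2) K.
Proof.
  induction K as [|K IH]; intros HK.
  - cbn [rsum]. rewrite (rsum_ext _ (fun _ => 0)) by (intros; ring).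
    rewrite rsum_const. ring.
  - set (t := fun j => 2 * PI * INR j / INR L).
    transitivity
      (rsum (fun j => (rsum (fun n => w n * cos (INR n * t j)) K ^ 2
                      + rsum (fun n => w n * sin (INR n * t j)) K ^ 2)
         + (2 * w K * rsum (fun n => w n * cos (INR (K - n) * t j)) K + w K ^ 2)) L).
    + apply rsum_ext. intros j _. fold (t j). cbn [rsum].
      assert (E : rsum (fun n => w n * cos (INR (K - n) * t j)) K
        = cos (INR K * t j) * rsum (fun n => w n * cos (INR n * t j)) K
          + sin (INR K * t j) * rsum (fun n => w n * sin (INR n * t j)) K).
      { rewrite <- !rsum_scal, <- rsum_plus. apply rsum_ext. intros n Hn.
        rewrite minus_INR by lia.
        rewrite Rmult_minus_distr_r, cos_minus. ring. }
      rewrite E. pose proof (sin2_cos2 (INR K * t j)) as H. unfold Rsqr in H.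
      generalize dependent (sin (INR K * t j)). intros s _ H.
      replace (w K ^ 2) with (w K ^ 2 * (s * s + cos (INR K * t j) * cos (INR K * t j)))
        by (rewrite H; ring).
      ring.
    + rewrite rsum_plus. unfold t at 1 2. rewrite IH by lia.
      rewrite rsum_plus, rsum_scal, rsum_exchange, rsum_const.
      assert (E : rsum (fun n => rsum (fun j => w n * cos (INR (K - n) * t j)) L) K = 0).
      { transitivity (rsum (fun _ => 0) K); [|rewrite rsum_const; ring].
        apply rsum_ext. intros n Hn. rewrite rsum_scal. unfold t.
        rewrite sum_cos_roots_of_unity by lia. ring. }
      rewrite E. cbn [rsum]. ring.
Qed.

Lemma parseval (f : nat -> R) (r : R) (L K : nat) : (K <= L)%nat ->
  rsum (fun j => Cmod (peval f K (root_of_unity r L j)) ^ 2) L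
  = INR L * rpeval (fun n => f n ^ 2) K (r ^ 2).
Proof.
  intros HK.
  transitivity (INR L * rsum (fun n => (f n * r ^ n) ^ 2) K).
  - rewrite <- (parseval_trig _ L K HK). apply rsum_ext. intros j _.
    rewrite Cmod2_alt. unfold root_of_unity.
    set (t := 2 * PI * INR j / INR L).
    assert (E : peval f K (r * cos t, r * sin t)
      = (rsum (fun n => f n * r ^ n * cos (INR n * t)) K,
         rsum (fun n => f n * r ^ n * sin (INR n * t)) K)).
    { unfold peval. clear HK. induction K as [|K IH]; simpl; [reflexivity|].
      rewrite IH, polar_pow. unfold Cplus, Cmult, RtoC; simpl. f_equal; ring. }
    rewrite E. reflexivity.
  - f_equal. unfold rpeval. apply rsum_ext. intros n _.
    rewrite Rpow_mult_distr, <- !pow_mult. f_equal. f_equal. lia.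
Qed.

(** * The averaged inequality *)

Lemma peval_succ_l (f : nat -> R) T (u : C) :
  peval f (S T) u = (RtoC (f O) + u * peval (fun n => f (S n)) T u)%C.
Proof.
  unfold peval. change (S T) with (1 + T)%nat. rewrite csum_add, <- csum_scal.
  simpl csum at 1. f_equal; [simpl; ring|].
  apply csum_ext. intros k _. change (1 + k)%nat with (S k). rewrite Cpow_S. ring.
Qed.

Lemma peval_plus (f g : nat -> R) T (u : C) :
  peval (fun n => f n + g n) T u = (peval f T u + peval g T u)%C.
Proof.
  unfold peval. rewrite <- csum_plus. apply csum_ext. intros k _.
  rewrite RtoC_plus. ring.
Qed.

Lemma peval_ext (f g : nat -> R) T (u : C) :
  (forall n, (n < T)%nat -> f n = g n) -> peval f T u = peval g T u.
Proof.
  intros H. apply csum_ext. intros k Hk. rewrite H by assumption. reflexivity.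
Qed.

(** Only the integrality of the coefficients of [P A] matters. One more term in [P] shifts [c] by
    one place and adds [a], padded by zeros from [T] on. *)
Lemma block_sum_coefficients (a : nat -> nat) (T M : nat) :
  exists c : nat -> nat, forall u : C,
    (peval (fun _ => 1) M u * peval (fun n => INR (a n)) T u)%C
    = peval (fun n => INR (c n)) (T + M) u.
Proof.
  set (a' := fun n => if (n <? T)%nat then a n else O).
  assert (Ha : forall K u,
    peval (fun n => INR (a' n)) (T + K) u = peval (fun n => INR (a n)) T u).
  { intros K u. induction K as [|K IH].
    - rewrite Nat.add_0_r. apply peval_ext. intros n Hn. unfold a'.
      destruct (Nat.ltb_spec n T); [reflexivity | lia].
    - rewrite Nat.add_succ_r. unfold peval in *. cbn [csum]. rewrite IH.
      unfold a' at 1. destruct (Nat.ltb_spec (T + K) T); [lia|]. simpl INR. ring. }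
  induction M as [|M [c Hc]].
  - exists (fun _ => O). intros u. unfold peval at 1. simpl csum at 1.
    rewrite Cmult_0_l. unfold peval. symmetry.
    generalize (T + 0)%nat. intros n. induction n as [|n IH]; [reflexivity|].
    cbn [csum]. rewrite IH. simpl INR. ring.
  - exists (fun n => (a' n + match n with O => O | S m => c m end)%nat). intros u.
    set (c' := fun n => match n with O => O | S m => c m end).
    transitivity (peval (fun n => INR (a' n) + INR (c' n)) (T + S M) u);
      [|apply peval_ext; intros; symmetry; apply plus_INR].
    rewrite peval_plus, Ha, Nat.add_succ_r, (peval_succ_l (fun n => INR (c' n))).
    unfold c'. rewrite <- Hc, peval_succ_l. simpl INR. ring.
Qed.

(* With [P = 1 + u + ... + u ^ (M - 1)] one has [(1 - u) P = 1 - u ^ M], so multiplying by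
   [|P| ^ 2] costs only one factor [|P|] on the error term [(1 - u) E]. The error is split by
   [2 |E| |P| <= tau |P| ^ 2 + |E| ^ 2 / tau]. *)
Lemma averaged_inequality (a : nat -> nat) (b e : nat -> R) (T M : nat) (r tau D : R) :
  (1 <= M)%nat -> 0 < r <= 1 -> 0 < tau ->
  (forall u, Cmod u = r ->
     Cmod (peval (fun n => INR (a n)) T u ^ 2 - peval b T u ^ 2
           - (1 - u) * peval e T u) <= D) ->
  rpeval (fun _ => 1) M (r ^ 2) * rpeval (fun n => INR (a n)) T (r ^ 2)
  <= INR M * rpeval (fun _ => 1) M (r ^ 2) * rpeval (fun n => b n ^ 2) T (r ^ 2)
     + tau * rpeval (fun _ => 1) M (r ^ 2)
     + rpeval (fun n => e n ^ 2) T (r ^ 2) / tau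
     + D * INR M ^ 2.
Proof.
  intros HM Hr Htau HD.
  destruct (block_sum_coefficients a T M) as [c Hc].
  set (P := peval (fun _ => 1) M).
  set (A := peval (fun n => INR (a n)) T) in *.
  set (P2 := rpeval (fun _ => 1) M (r ^ 2)).
  (* [|P|] is at most the sum of [r ^ n]; Cauchy-Schwarz against the constant [1] bounds its square
     by [M] times the sum of [r ^ (2 n)]. *)
  assert (HP2 : forall u, Cmod u = r -> Cmod (P u) ^ 2 <= INR M * P2).
  { intros u Hu.
    assert (H1 : Cmod (P u) <= rsum (fun n => 1 * r ^ n) M).
    { eapply Rle_trans; [apply peval_bound|]. right. apply rsum_ext. intros k _.
      rewrite Hu, Rabs_R1. reflexivity. }
    eapply Rle_trans; [apply pow_incr; split; [apply Cmod_ge_0 | exact H1]|].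
    eapply Rle_trans; [apply rsum_cauchy_schwarz|]. right. f_equal.
    - rewrite (rsum_ext _ (fun _ => 1)) by (intros; ring). rewrite rsum_const. ring.
    - unfold P2, rpeval. apply rsum_ext. intros k _.
      rewrite <- !pow_mult, Nat.mul_comm. ring. }
  assert (HPM : forall u, Cmod u = r -> Cmod (P u) <= INR M).
  { intros u Hu. eapply Rle_trans; [apply peval_bound|].
    rewrite <- (Rmult_1_r (INR M)), <- rsum_const. apply rsum_le. intros k _.
    rewrite Hu, Rabs_R1, Rmult_1_l. rewrite <- (pow1 k). apply pow_incr. lra. }
  assert (Hpt : forall u, Cmod u = r ->
    Cmod (P u * A u) ^ 2
    <= INR M * P2 * Cmod (peval b T u) ^ 2
       + (tau * Cmod (P u) ^ 2 + / tau * Cmod (peval e T u) ^ 2) + D * INR M ^ 2).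
  { intros u Hu. specialize (HP2 u Hu). specialize (HD u Hu). specialize (HPM u Hu).
    set (B := peval b T u) in *. set (E := peval e T u) in *.
    set (Delta := (A u ^ 2 - B ^ 2 - (1 - u) * E)%C) in *.
    pose proof (Cmod_ge_0 (P u)) as p0. pose proof (Cmod_ge_0 B) as b0.
    pose proof (Cmod_ge_0 E) as e0. pose proof (Cmod_ge_0 Delta) as d0.
    assert (H1 : Cmod (A u) ^ 2 <= Cmod B ^ 2 + Cmod (1 - u) * Cmod E + D).
    { rewrite <- !Cmod_pow, <- Cmod_mult.
      replace (A u ^ 2)%C with (B ^ 2 + (1 - u) * E + Delta)%C by (unfold Delta; ring).
      eapply Rle_trans; [apply Cmod_triangle|].
      pose proof (Cmod_triangle (B ^ 2) ((1 - u) * E)). lra. }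
    assert (H2 : Cmod (1 - u) * Cmod (P u) <= 2).
    { rewrite <- Cmod_mult. unfold P. rewrite geometric_sum.
      eapply Rle_trans; [apply Cmod_triangle|].
      rewrite Cmod_1, Cmod_opp, Cmod_pow, Hu.
      assert (r ^ M <= 1) by (rewrite <- (pow1 M); apply pow_incr; lra). lra. }
    assert (H3 : 2 * (Cmod E * Cmod (P u))
                 <= tau * Cmod (P u) ^ 2 + / tau * Cmod E ^ 2).
    { assert (0 <= tau * (Cmod (P u) - / tau * Cmod E) ^ 2)
        by (apply Rmult_le_pos; [lra | apply pow2_ge_0]).
      replace (tau * (Cmod (P u) - / tau * Cmod E) ^ 2) with
        (tau * Cmod (P u) ^ 2 + / tau * Cmod E ^ 2 - 2 * (Cmod E * Cmod (P u))) in H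
        by (field; lra).
      lra. }
    rewrite Cmod_mult, Rpow_mult_distr.
    apply Rle_trans with
      (Cmod (P u) ^ 2 * (Cmod B ^ 2 + Cmod (1 - u) * Cmod E + D));
      [apply Rmult_le_compat_l; [apply pow2_ge_0 | assumption]|].
    assert (Cmod (P u) ^ 2 * Cmod B ^ 2 <= INR M * P2 * Cmod B ^ 2)
      by (apply Rmult_le_compat_r; [apply pow2_ge_0 | assumption]).
    assert (Cmod (P u) ^ 2 * (Cmod (1 - u) * Cmod E) <= 2 * (Cmod E * Cmod (P u))).
    { replace (Cmod (P u) ^ 2 * (Cmod (1 - u) * Cmod E)) with
        (Cmod (1 - u) * Cmod (P u) * (Cmod E * Cmod (P u))) by ring.
      apply Rmult_le_compat_r; [nra | assumption]. }
    assert (Cmod (P u) ^ 2 * D <= D * INR M ^ 2).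
    { rewrite Rmult_comm. apply Rmult_le_compat_l; [lra|]. apply pow_incr. lra. }
    lra. }
  (* [P A] has [T + M] coefficients, so this many nodes make Parseval exact for [P A], [P] and the
     series of [b] and [e] at once. *)
  set (L := (T + M)%nat).
  assert (HL : 0 < INR L) by (apply lt_0_INR; unfold L; lia).
  assert (Hsum :
    rsum (fun j => Cmod (P (root_of_unity r L j) * A (root_of_unity r L j)) ^ 2) L
    <= rsum (fun j => INR M * P2 * Cmod (peval b T (root_of_unity r L j)) ^ 2
         + (tau * Cmod (P (root_of_unity r L j)) ^ 2
            + / tau * Cmod (peval e T (root_of_unity r L j)) ^ 2) + D * INR M ^ 2) L)
    by (apply rsum_le; intros j _; apply Hpt, Cmod_root_of_unity; lra).
  rewrite !rsum_plus, !rsum_scal, rsum_const in Hsum.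
  rewrite (rsum_ext _ (fun j => Cmod (peval (fun n => INR (c n)) L (root_of_unity r L j)) ^ 2))
    in Hsum by (intros j _; unfold P, A; rewrite Hc; reflexivity).
  unfold P in Hsum. rewrite !parseval in Hsum by (unfold L; lia).
  assert (HP1 : rpeval (fun _ => 1 ^ 2) M (r ^ 2) = P2)
    by (unfold P2, rpeval; apply rsum_ext; intros; ring).
  rewrite HP1 in Hsum.
  (* the coefficients of [P A] are natural numbers, hence at most their squares *)
  assert (Hlow : P2 * rpeval (fun n => INR (a n)) T (r ^ 2)
                 <= rpeval (fun n => INR (c n) ^ 2) L (r ^ 2)).
  { replace (P2 * rpeval (fun n => INR (a n)) T (r ^ 2))
      with (rpeval (fun n => INR (c n)) L (r ^ 2)).
    - apply rsum_le. intros k _. apply Rmult_le_compat_r.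
      + apply pow_le, pow2_ge_0.
      + destruct (c k) as [|m]; [simpl; lra|]. rewrite S_INR.
        pose proof (pos_INR m). nra.
    - apply RtoC_inj. rewrite <- peval_RtoC. unfold L. rewrite <- Hc, !peval_RtoC.
      rewrite RtoC_mult. unfold A. rewrite peval_RtoC. reflexivity. }
  apply Rmult_le_reg_l with (INR L); [assumption|].
  eapply Rle_trans; [apply Rmult_le_compat_l; [lra | exact Hlow]|].
  eapply Rle_trans; [exact Hsum|]. right. field. lra.
Qed.

(** * The truncated generating function identity *)

(** Both sides run over the pairs with [i + j < T], by diagonals and by rows. *)
Lemma csum_triangle (F : nat -> nat -> C) T :
  csum (fun n => csum (fun k => F k (n - k)%nat) (S n)) T
  = csum (fun i => csum (F i) (T - i)) T.
Proof.
  induction T as [|T IH]; [reflexivity|].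
  transitivity (csum (fun i => (csum (F i) (T - i) + F i (T - i)%nat)%C) (S T)).
  - rewrite csum_plus. cbn [csum] in *. rewrite IH, Nat.sub_diag. simpl. ring.
  - apply csum_ext. intros i Hi. replace (S T - i)%nat with (S (T - i)) by lia.
    reflexivity.
Qed.

Lemma RtoC_rsum (f : nat -> R) n : RtoC (rsum f n) = csum (fun k => RtoC (f k)) n.
Proof. induction n as [|n IH]; simpl; [|rewrite RtoC_plus, IH]; reflexivity. Qed.

Lemma conv_rsum (f : nat -> R) n : conv f n = rsum (fun k => f k * f (n - k)%nat) (S n).
Proof. exact (psum_rsum _ n). Qed.

Lemma peval_tail_bound (f : nat -> R) (beta : R) (u : C) (m n : nat) :
  (forall k, Rabs (f k) <= beta) -> Cmod u <= 1 ->
  Cmod (peval f (m + n) u - peval f m u) <= INR n * (beta * Cmod u ^ m).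
Proof.
  intros Hf Hu. unfold peval. rewrite csum_add.
  pose proof (Cmod_ge_0 u) as H0.
  match goal with |- Cmod (?x + ?y - ?x) <= _ => replace (x + y - x)%C with y by ring end.
  eapply Rle_trans; [apply csum_Cmod_le|]. rewrite <- rsum_const.
  apply rsum_le. intros k _. rewrite Cmod_mult, Cmod_R, Cmod_pow, pow_add.
  apply Rmult_le_compat; [apply Rabs_pos| |apply Hf|].
  - apply Rmult_le_pos; apply pow_le; assumption.
  - rewrite <- (Rmult_1_r (Cmod u ^ m)) at 2.
    apply Rmult_le_compat_l; [apply pow_le; assumption|].
    rewrite <- (pow1 k). apply pow_incr. lra.
Qed.

(** The two expressions differ by the pairs [i, j < T] with [i + j >= T]: at most [T ^ 2] terms,
    each at most [beta ^ 2 |u| ^ T]. *)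
Lemma square_truncation (f : nat -> R) (beta : R) (u : C) (T : nat) :
  (forall k, Rabs (f k) <= beta) -> Cmod u <= 1 ->
  Cmod (peval f T u ^ 2 - peval (conv f) T u) <= INR T ^ 2 * beta ^ 2 * Cmod u ^ T.
Proof.
  intros Hf Hu. pose proof (Cmod_ge_0 u) as H0.
  assert (Hb : 0 <= beta) by (pose proof (Rabs_pos (f O)); specialize (Hf O); lra).
  assert (E : peval (conv f) T u
              = csum (fun i => (RtoC (f i) * u ^ i * peval f (T - i) u)%C) T).
  { transitivity (csum (fun i => csum (fun j => (RtoC (f i) * u ^ i * (RtoC (f j) * u ^ j))%C)
                                      (T - i)) T).
    - rewrite <- csum_triangle. apply csum_ext. intros n _.
      rewrite conv_rsum, RtoC_rsum, Cmult_comm, <- csum_scal.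
      apply csum_ext. intros k Hk. rewrite RtoC_mult.
      replace (u ^ n)%C with (u ^ k * u ^ (n - k))%C
        by (rewrite <- Cpow_add_r; f_equal; lia).
      ring.
    - apply csum_ext. intros i _. apply csum_scal. }
  rewrite E. clear E.
  replace (peval f T u ^ 2 - csum (fun i => (RtoC (f i) * u ^ i * peval f (T - i) u)%C) T)%C
    with (csum (fun i => (RtoC (f i) * u ^ i * (peval f T u - peval f (T - i) u))%C) T).
  - eapply Rle_trans; [apply csum_Cmod_le|].
    replace (INR T ^ 2 * beta ^ 2 * Cmod u ^ T)
      with (INR T * (INR T * (beta ^ 2 * Cmod u ^ T))) by ring.
    rewrite <- rsum_const. apply rsum_le. intros i Hi.
    rewrite !Cmod_mult, Cmod_R, Cmod_pow.
    assert (H : Cmod (peval f T u - peval f (T - i) u)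
                <= INR i * (beta * Cmod u ^ (T - i))).
    { replace T with (T - i + i)%nat at 1 by lia. apply peval_tail_bound; assumption. }
    apply Rle_trans with (beta * Cmod u ^ i * (INR i * (beta * Cmod u ^ (T - i)))).
    + apply Rmult_le_compat; [| apply Cmod_ge_0 | | exact H].
      * apply Rmult_le_pos; [apply Rabs_pos | apply pow_le; assumption].
      * apply Rmult_le_compat_r; [apply pow_le; assumption | apply Hf].
    + replace (Cmod u ^ T) with (Cmod u ^ i * Cmod u ^ (T - i))
        by (rewrite <- pow_add; f_equal; lia).
      replace (beta * Cmod u ^ i * (INR i * (beta * Cmod u ^ (T - i))))
        with (INR i * (beta ^ 2 * (Cmod u ^ i * Cmod u ^ (T - i)))) by ring.
      apply Rmult_le_compat_r; [| apply le_INR; lia].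
      apply Rmult_le_pos; [apply pow2_ge_0|].
      apply Rmult_le_pos; apply pow_le; assumption.
  - transitivity (csum (fun i => (peval f T u * (RtoC (f i) * u ^ i)
        + (- 1) * (RtoC (f i) * u ^ i * peval f (T - i) u))%C) T).
    + apply csum_ext. intros i _. ring.
    + rewrite csum_plus, !csum_scal.
      change (csum (fun k => (RtoC (f k) * u ^ k)%C) T) with (peval f T u). ring.
Qed.

Lemma psum_conv_bound (f : nat -> R) (beta : R) n :
  (forall k, Rabs (f k) <= beta) -> Rabs (psum (conv f) n) <= INR (S n) ^ 2 * beta ^ 2.
Proof.
  intros Hf.
  assert (Hb : 0 <= beta) by (pose proof (Rabs_pos (f O)); specialize (Hf O); lra).
  rewrite psum_rsum. eapply Rle_trans; [apply rsum_abs_le|].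
  replace (INR (S n) ^ 2 * beta ^ 2) with (INR (S n) * (INR (S n) * beta ^ 2)) by ring.
  rewrite <- rsum_const. apply rsum_le. intros k Hk. rewrite conv_rsum.
  eapply Rle_trans; [apply rsum_abs_le|].
  apply Rle_trans with (INR (S k) * beta ^ 2).
  - rewrite <- rsum_const. apply rsum_le. intros i _. rewrite Rabs_mult.
    replace (beta ^ 2) with (beta * beta) by ring.
    apply Rmult_le_compat; auto using Rabs_pos.
  - apply Rmult_le_compat_r; [apply pow2_ge_0 | apply le_INR; lia].
Qed.

(** The factor [4] collects one unit of [beta ^ 2 T ^ 2 |u| ^ T] for truncating each square and two
    for the boundary term of the Abel summation. *)
Lemma truncated_identity (a b e : nat -> R) (beta : R) (u : C) (T : nat) :
  (forall k, Rabs (a k) <= beta) -> (forall k, Rabs (b k) <= beta) ->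
  (forall n, psum (conv a) n = psum (conv b) n + e n) ->
  Cmod u <= 1 -> (1 <= T)%nat ->
  Cmod (peval a T u ^ 2 - peval b T u ^ 2 - (1 - u) * peval e T u)
  <= 4 * beta ^ 2 * INR T ^ 2 * Cmod u ^ T.
Proof.
  intros Ha Hb He Hu HT. destruct T as [|t]; [lia|]. clear HT.
  (* Abel summation: differencing the hypothesis gives [conv a n - conv b n = e n - e (n - 1)], and
     the shift by one becomes the factor [1 - u]. *)
  assert (Habel : forall t, (peval (conv a) (S t) u - peval (conv b) (S t) u
                   = (1 - u) * peval e (S t) u + RtoC (e t) * u ^ (S t))%C).
  { clear t. intros t. induction t as [|t IH].
    - specialize (He O). unfold psum in He. simpl in He.
      unfold peval. simpl. rewrite He, RtoC_plus. ring.
    - assert (E : conv a (S t) = conv b (S t) + e (S t) - e t).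
      { pose proof (He t) as H1. pose proof (He (S t)) as H2.
        unfold psum in *. simpl sum_f_R0 in H2. lra. }
      remember (S t) as s. unfold peval in *. cbn [csum].
      rewrite E, RtoC_minus, RtoC_plus, (Cpow_S u s).
      match goal with
      | |- (?x + _ - (?y + _))%C = _ =>
        match type of IH with (x - y)%C = ?z => replace x with (y + z)%C by (rewrite <- IH; ring) end
      end.
      ring. }
  specialize (Habel t). remember (S t) as T.
  pose proof (square_truncation a beta u T Ha Hu) as HA.
  pose proof (square_truncation b beta u T Hb Hu) as HB.
  replace (peval a T u ^ 2 - peval b T u ^ 2 - (1 - u) * peval e T u)%C
    with ((peval a T u ^ 2 - peval (conv a) T u)
          + - (peval b T u ^ 2 - peval (conv b) T u) + RtoC (e t) * u ^ T)%C.
  - eapply Rle_trans; [apply Cmod_triangle|].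
    pose proof (Cmod_triangle (peval a T u ^ 2 - peval (conv a) T u)
                 (- (peval b T u ^ 2 - peval (conv b) T u))) as H.
    rewrite Cmod_opp in H.
    assert (Het : Rabs (e t) <= 2 * (INR T ^ 2 * beta ^ 2)).
    { replace (e t) with (psum (conv a) t - psum (conv b) t) by (rewrite He; ring).
      pose proof (psum_conv_bound a beta t Ha) as H1.
      pose proof (psum_conv_bound b beta t Hb) as H2.
      rewrite <- HeqT in H1, H2.
      unfold Rminus. eapply Rle_trans; [apply Rabs_triang|]. rewrite Rabs_Ropp. lra. }
    rewrite Cmod_mult, Cmod_R, Cmod_pow.
    assert (Rabs (e t) * Cmod u ^ T <= 2 * (INR T ^ 2 * beta ^ 2) * Cmod u ^ T)
      by (apply Rmult_le_compat_r; [apply pow_le, Cmod_ge_0 | assumption]).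
    lra.
  - match type of Habel with ?l = ?r =>
      replace (RtoC (e t) * u ^ T)%C with (l - (1 - u) * peval e T u)%C
        by (rewrite Habel; ring) end.
    ring.
Qed.

(** * Transfer from partial sums to power series *)

Lemma pow_le_1 (x : R) n : 0 <= x <= 1 -> x ^ n <= 1.
Proof. intros H. rewrite <- (pow1 n). apply pow_incr. assumption. Qed.

Lemma pow_antitone (x : R) m n : 0 <= x <= 1 -> (m <= n)%nat -> x ^ n <= x ^ m.
Proof.
  intros Hx Hmn. replace n with (m + (n - m))%nat by lia. rewrite pow_add.
  rewrite <- (Rmult_1_r (x ^ m)) at 2.
  apply Rmult_le_compat_l; [apply pow_le; lra | apply pow_le_1; assumption].
Qed.

(** On the block from [k N] to [(k + 1) N] the weights are at most [x ^ (k N)], and the block mass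
    is at most the whole partial sum. *)
Lemma power_series_block_bound (f : nat -> R) (x : R) (N K : nat) :
  (forall n, 0 <= f n) -> 0 <= x <= 1 ->
  rpeval f (K * N) x <= rsum (fun k => (x ^ N) ^ k * psum f ((k + 1) * N)) K.
Proof.
  intros Hf Hx. induction K as [|K IH]; [unfold rpeval; simpl; lra|].
  replace (S K * N)%nat with (K * N + N)%nat by lia.
  unfold rpeval in *. rewrite rsum_add. cbn [rsum].
  apply Rplus_le_compat; [exact IH|].
  apply Rle_trans with ((x ^ N) ^ K * rsum (fun k => f (K * N + k)%nat) N).
  - rewrite <- rsum_scal. apply rsum_le. intros k _. rewrite Rmult_comm.
    apply Rmult_le_compat_r; [apply Hf|].
    rewrite <- pow_mult, Nat.mul_comm. apply pow_antitone; [assumption | lia].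
  - apply Rmult_le_compat_l; [apply pow_le, pow_le; lra|].
    rewrite psum_rsum.
    apply Rle_trans with (rsum f (K * N + N)).
    + rewrite rsum_add.
      assert (0 <= rsum f (K * N)) by (apply rsum_ge_0; auto). lra.
    + apply rsum_monotone; [lia | auto].
Qed.

Lemma half_geometric_bound (y : R) K : 0 <= y <= / 2 -> rsum (fun k => y ^ k) K <= 2.
Proof.
  intros Hy. pose proof (geometric_rsum y K) as H. unfold rpeval in H.
  rewrite (rsum_ext _ (fun k => y ^ k)) in H by (intros; ring).
  assert (0 <= y ^ K) by (apply pow_le; lra).
  assert (0 <= rsum (fun k => y ^ k) K) by (apply rsum_ge_0; intros; apply pow_le; lra).
  nra.
Qed.

(** The bound is on the products [G k * H l] because hypothesis (4) controls only the product of the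
    two partial sums. Each of the two summations is geometric with ratio [q D <= 1/2] and costs a
    factor [2]. *)
Lemma weighted_product_bound (G H : nat -> R) (q D Z : R) K :
  0 <= q -> 0 <= D -> q * D <= / 2 -> 0 <= Z ->
  (forall k l, G k * H l <= Z * D ^ (k + l)) ->
  rsum (fun k => q ^ k * G k) K * rsum (fun l => q ^ l * H l) K <= 4 * Z.
Proof.
  intros Hq HD HqD HZ HGH.
  assert (Hgeo : rsum (fun k => (q * D) ^ k) K <= 2)
    by (apply half_geometric_bound; nra).
  set (SH := rsum (fun l => q ^ l * H l) K).
  assert (Hk : forall k, G k * SH <= 2 * Z * D ^ k).
  { intros k. unfold SH. rewrite <- rsum_scal.
    apply Rle_trans with (rsum (fun l => Z * D ^ k * (q * D) ^ l) K).
    - apply rsum_le. intros l _. rewrite Rpow_mult_distr.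
      replace (G k * (q ^ l * H l)) with (q ^ l * (G k * H l)) by ring.
      replace (Z * D ^ k * (q ^ l * D ^ l)) with (q ^ l * (Z * D ^ (k + l)))
        by (rewrite pow_add; ring).
      apply Rmult_le_compat_l; [apply pow_le; lra | apply HGH].
    - rewrite rsum_scal. replace (2 * Z * D ^ k) with (Z * D ^ k * 2) by ring.
      apply Rmult_le_compat_l; [|exact Hgeo].
      apply Rmult_le_pos; [lra | apply pow_le; lra]. }
  rewrite Rmult_comm, <- rsum_scal.
  apply Rle_trans with (rsum (fun k => 2 * Z * (q * D) ^ k) K).
  - apply rsum_le. intros k _. rewrite Rpow_mult_distr.
    replace (SH * (q ^ k * G k)) with (q ^ k * (G k * SH)) by ring.
    replace (2 * Z * (q ^ k * D ^ k)) with (q ^ k * (2 * Z * D ^ k)) by ring.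
    apply Rmult_le_compat_l; [apply pow_le; lra | apply Hk].
  - rewrite rsum_scal. replace (4 * Z) with (2 * Z * 2) by ring.
    apply Rmult_le_compat_l; [lra | exact Hgeo].
Qed.

(** Since [k + 1 <= 2 ^ k], [k] doublings starting at [N] reach past [(k + 1) N]. *)
Lemma doubling_growth (B : nat -> R) (C : R) (n0 N : nat) :
  (forall m n, (n0 <= m)%nat -> (m <= n)%nat -> B m <= B n) ->
  (forall n, (n0 <= n)%nat -> B (2 * n)%nat <= C * B n) ->
  0 <= C -> (n0 <= N)%nat ->
  forall k, B ((k + 1) * N)%nat <= C ^ k * B N.
Proof.
  intros Hmono Hdbl HC HN k.
  assert (Hpow : forall k, (k + 1 <= 2 ^ k)%nat)
    by (intros i; induction i as [|i IHi]; simpl; lia).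
  apply Rle_trans with (B (2 ^ k * N)%nat).
  - specialize (Hpow k). apply Hmono; nia.
  - induction k as [|k IH]; [simpl; rewrite Nat.add_0_r; lra|].
    replace (2 ^ S k * N)%nat with (2 * (2 ^ k * N))%nat by (simpl; lia).
    eapply Rle_trans; [apply Hdbl; specialize (Hpow k); nia|].
    simpl pow. rewrite Rmult_assoc. apply Rmult_le_compat_l; assumption.
Qed.

Lemma psum_monotone (f : nat -> R) n0 m n :
  (forall k, (n0 <= k)%nat -> 0 <= f k) -> (n0 <= m)%nat -> (m <= n)%nat ->
  psum f m <= psum f n.
Proof.
  intros Hf Hm Hmn. rewrite !psum_rsum. apply rsum_monotone; [lia|].
  intros; apply Hf; lia.
Qed.

(* Since the weight [x ^ N] of a block of length [N] beats the cube of the doubling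
   constant, the tails of both series are dominated by their first block. *)
Lemma power_series_product_bound (b f g : nat -> R) (C eta x : R) (n0 N K : nat) :
  (forall n, (n0 <= n)%nat -> 0 <= b n) ->
  (forall n, 0 <= f n) -> (forall n, 0 <= g n) ->
  (forall n, (n0 <= n)%nat -> psum b (2 * n) <= C * psum b n) ->
  1 <= C -> 0 <= eta -> (n0 <= N)%nat -> (1 <= N)%nat -> 0 <= psum b N ->
  (forall n, (N <= n)%nat -> psum f n * psum g n <= eta * psum b n ^ 3) ->
  0 <= x <= 1 -> x ^ N * C ^ 3 <= / 2 ->
  rpeval f (K * N) x * rpeval g (K * N) x <= 4 * (eta * psum b N ^ 3).
Proof.
  intros Hb Hf Hg Hdbl HC Heta HN HN1 HBN Hfg Hx HxN.
  assert (Hpos : forall h, (forall n, 0 <= h n) -> forall n, 0 <= psum h n)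
    by (intros h Hh n; rewrite psum_rsum; apply rsum_ge_0; auto).
  assert (Hr : forall h, (forall n, 0 <= h n) -> 0 <= rpeval h (K * N) x)
    by (intros h Hh; apply rsum_ge_0; intros; apply Rmult_le_pos; [auto | apply pow_le; lra]).
  eapply Rle_trans.
  { apply Rmult_le_compat; [auto | auto | |];
      apply power_series_block_bound; assumption. }
  apply weighted_product_bound with (C ^ 3).
  - apply pow_le; lra.
  - apply pow_le; lra.
  - assumption.
  - apply Rmult_le_pos; [assumption | apply pow_le; assumption].
  (* Monotonicity moves both partial sums to the common index [(m + 1) N], where [Hfg] applies; then
     [m <= k + l] bounds the growth factor [C ^ (3 m)]. *)
  - intros k l. set (m := Nat.max k l).
    apply Rle_trans with (psum f ((m + 1) * N) * psum g ((m + 1) * N)).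
    { apply Rmult_le_compat; [auto | auto | |]; apply psum_monotone with O; auto;
        unfold m; nia. }
    eapply Rle_trans; [apply Hfg; nia|].
    rewrite Rmult_assoc. apply Rmult_le_compat_l; [assumption|].
    apply Rle_trans with ((C ^ m * psum b N) ^ 3).
    { apply pow_incr. split.
      - apply Rle_trans with (psum b N); [assumption|].
        apply psum_monotone with n0; auto; nia.
      - apply doubling_growth with n0; auto; [|lra].
        intros; apply psum_monotone with n0; auto. }
    rewrite Rpow_mult_distr, Rmult_comm.
    apply Rmult_le_compat_l; [apply pow_le; assumption|].
    rewrite <- !pow_mult. apply Rle_pow; [assumption|]. unfold m. nia.
Qed.

(** Up to [N] the weights are at least [x ^ N], and the terms beyond are nonnegative. The terms
    before [n0] have unknown sign, whence the subtracted constant. *)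
Lemma power_series_lower_bound (b : nat -> R) (x : R) (n0 N T : nat) :
  (forall n, (n0 <= n)%nat -> 0 <= b n) -> 0 <= x <= 1 ->
  (n0 <= N)%nat -> (N < T)%nat ->
  x ^ N * psum b N - rsum (fun n => Rabs (b n)) n0 <= rpeval b T x.
Proof.
  intros Hb Hx HN HT.
  apply Rle_trans with (rpeval b (S N) x).
  - rewrite psum_rsum. unfold rpeval.
    replace (S N) with (n0 + (S N - n0))%nat by lia. rewrite !rsum_add.
    set (m := (S N - n0)%nat).
    assert (H1 : x ^ N * rsum (fun k => b (n0 + k)%nat) m
                 <= rsum (fun k => b (n0 + k)%nat * x ^ (n0 + k)) m).
    { rewrite <- rsum_scal. apply rsum_le. intros k Hk. rewrite Rmult_comm.
      apply Rmult_le_compat_l; [apply Hb; lia|].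
      apply pow_antitone; [assumption | unfold m in Hk; lia]. }
    assert (H2 : x ^ N * rsum b n0
                 <= rsum (fun k => b k * x ^ k) n0 + rsum (fun k => Rabs (b k)) n0).
    { rewrite <- rsum_scal, <- rsum_plus. apply rsum_le. intros k Hk.
      assert (x ^ N <= x ^ k) by (apply pow_antitone; [assumption | lia]).
      assert (x ^ k <= 1) by (apply pow_le_1; assumption).
      assert (0 <= x ^ N) by (apply pow_le; lra).
      unfold Rabs. destruct (Rcase_abs (b k)); nra. }
    lra.
  - apply rsum_monotone; [lia|]. intros k Hk.
    apply Rmult_le_pos; [apply Hb; lia | apply pow_le; lra].
Qed.

(** From [n0] on, [b ^ 2 <= rho b]; the earlier terms cost a constant independent of [x] and [T]. *)
Lemma power_series_square_bound (b : nat -> R) (rho x : R) (n0 T : nat) :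
  (forall n, (n0 <= n)%nat -> 0 <= b n <= rho) -> 0 <= rho <= 1 -> 0 <= x <= 1 ->
  rpeval (fun n => b n ^ 2) T x
  <= rho * rpeval b T x + rsum (fun n => Rabs (b n) + b n ^ 2) n0.
Proof.
  intros Hb Hrho Hx.
  set (h := fun n => if (n <? n0)%nat then Rabs (b n) + b n ^ 2 else 0).
  assert (Hh : forall n, 0 <= h n).
  { intros n. unfold h. destruct (n <? n0)%nat; [|lra].
    pose proof (Rabs_pos (b n)). pose proof (pow2_ge_0 (b n)). lra. }
  apply Rle_trans with (rho * rpeval b T x + rsum h T).
  - unfold rpeval. rewrite <- rsum_scal, <- rsum_plus. apply rsum_le. intros n _.
    assert (Hxn : 0 <= x ^ n <= 1) by (split; [apply pow_le; lra | apply pow_le_1; assumption]).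
    unfold h. destruct (Nat.ltb_spec n n0) as [Hn|Hn].
    + assert (0 <= b n ^ 2) by apply pow2_ge_0.
      assert (b n ^ 2 * x ^ n <= b n ^ 2) by nra.
      assert (- Rabs (b n) <= rho * (b n * x ^ n)).
      { assert (0 <= rho * x ^ n <= 1) by nra.
        unfold Rabs. destruct (Rcase_abs (b n)); nra. }
      lra.
    + specialize (Hb n Hn). assert (b n ^ 2 <= rho * b n) by nra. nra.
  - apply Rplus_le_compat_l.
    apply Rle_trans with (rsum h (n0 + T)); [apply rsum_monotone; [lia | auto]|].
    rewrite rsum_add. right.
    rewrite (rsum_ext (fun k => h (n0 + k)%nat) (fun _ => 0)).
    + rewrite rsum_const, Rmult_0_r, Rplus_0_r. apply rsum_ext. intros k Hk. unfold h.
      destruct (Nat.ltb_spec k n0); [reflexivity | lia].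
    + intros k _. unfold h. destruct (Nat.ltb_spec (n0 + k) n0); [lia | reflexivity].
Qed.

(** Split the weight as [r ^ n * r ^ n] and use that the geometric sum at [r ^ 2] is at most
    [1 / (1 - r ^ 2)]. It serves for both [b] and [e]. *)
Lemma power_series_cauchy_schwarz (f : nat -> R) (r : R) (T : nat) :
  0 <= r < 1 ->
  (1 - r ^ 2) * rpeval f T (r ^ 2) ^ 2 <= rpeval (fun n => f n ^ 2) T (r ^ 2).
Proof.
  intros Hr.
  assert (Hx : 0 <= r ^ 2 < 1) by nra.
  assert (H : rpeval f T (r ^ 2) ^ 2
              <= rpeval (fun n => f n ^ 2) T (r ^ 2) * rpeval (fun _ => 1) T (r ^ 2)).
  { unfold rpeval.
    rewrite (rsum_ext (fun n => f n * (r ^ 2) ^ n) (fun n => (f n * r ^ n) * r ^ n)).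
    - eapply Rle_trans; [apply rsum_cauchy_schwarz|]. right. f_equal; apply rsum_ext; intros n _;
      rewrite ?Rpow_mult_distr, <- !pow_mult, (Nat.mul_comm n 2); ring.
    - intros n _. rewrite <- pow_mult. replace (2 * n)%nat with (n + n)%nat by lia.
      rewrite pow_add. ring. }
  pose proof (geometric_rsum (r ^ 2) T) as Hg.
  assert (0 <= (r ^ 2) ^ T) by (apply pow_le; lra).
  assert (0 <= rpeval (fun n => f n ^ 2) T (r ^ 2))
    by (apply rsum_ge_0; intros; apply Rmult_le_pos; [apply pow2_ge_0 | apply pow_le; lra]).
  apply Rle_trans with (rpeval (fun n => f n ^ 2) T (r ^ 2)
                        * ((1 - r ^ 2) * rpeval (fun _ => 1) T (r ^ 2))).
  - rewrite <- Rmult_assoc, (Rmult_comm _ (1 - r ^ 2)), Rmult_assoc.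
    apply Rmult_le_compat_l; [lra | exact H].
  - rewrite Hg. nra.
Qed.

(** * The case of an unbounded mass [psum b] *)

Lemma exists_nth_root (p : R) (N : nat) :
  0 < p < 1 -> (1 <= N)%nat -> exists r, 0 < r < 1 /\ r ^ N = p.
Proof.
  intros Hp HN. assert (HNR : 0 < INR N) by (apply lt_0_INR; lia).
  exists (Rpower p (/ INR N)).
  assert (Hpow : Rpower p (/ INR N) ^ N = p).
  { rewrite <- Rpower_pow by apply exp_pos. rewrite Rpower_mult, Rinv_l by lra.
    apply Rpower_1; lra. }
  assert (0 < Rpower p (/ INR N)) by apply exp_pos.
  repeat split; [assumption | | assumption].
  destruct (Rlt_or_le (Rpower p (/ INR N)) 1) as [H1|H1]; [assumption|].
  pose proof (pow_R1_Rle _ N H1). lra.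
Qed.

(** From [K <= 2 ^ K] the product is at most [(8 p) ^ K]. This makes the truncation error
    negligible. *)
Lemma cube_pow_le_1 (p : R) (K : nat) : 0 <= p <= / 16 -> INR K ^ 3 * p ^ K <= 1.
Proof.
  intros Hp.
  assert (HK : INR K <= 2 ^ K).
  { clear Hp. induction K as [|K IH]; [simpl; lra|]. rewrite S_INR. simpl.
    assert (1 <= 2 ^ K) by (apply pow_R1_Rle; lra). lra. }
  apply Rle_trans with ((2 ^ K) ^ 3 * p ^ K).
  - apply Rmult_le_compat_r; [apply pow_le; lra|]. apply pow_incr.
    split; [apply pos_INR | assumption].
  - rewrite <- pow_mult, Nat.mul_comm, pow_mult, <- Rpow_mult_distr.
    apply pow_le_1. simpl. lra.
Qed.

Lemma ceil_nat (z : R) : 0 <= z -> exists M : nat, (1 <= M)%nat /\ z <= INR M <= z + 1.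
Proof.
  intros Hz. destruct (archimed z) as [H1 H2].
  assert (Hup : (0 < up z)%Z) by (apply lt_IZR; lra).
  exists (Z.to_nat (up z)). rewrite INR_IZR_INZ, Z2Nat.id by lia.
  split; [lia | lra].
Qed.

Lemma sub_geometric_bounds (x : R) (M : nat) :
  0 <= x <= 1 -> (1 <= M)%nat ->
  1 <= rpeval (fun _ => 1) M x /\ INR M * x ^ M <= rpeval (fun _ => 1) M x <= INR M.
Proof.
  intros Hx HM. unfold rpeval. repeat split.
  - destruct M as [|M]; [lia|]. change (S M) with (1 + M)%nat. rewrite rsum_add.
    assert (0 <= rsum (fun k => 1 * x ^ (1 + k)) M)
      by (apply rsum_ge_0; intros; apply Rmult_le_pos; [lra | apply pow_le; lra]).
    simpl rsum at 1. lra.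
  - rewrite <- rsum_const. apply rsum_le. intros k Hk. rewrite Rmult_1_l.
    apply pow_antitone; [assumption | lia].
  - rewrite <- (Rmult_1_r (INR M)), <- rsum_const. apply rsum_le. intros k Hk.
    rewrite Rmult_1_l. apply pow_le_1; assumption.
Qed.

(* [A], [B], [Sb], [Se], [E] are the truncated series of [a], [b], [b ^ 2], [e ^ 2], [e]
   at [x]. The block length is [M ~ kappa * B / Sb]; the final [+ 1] keeps [M >= 1] at the
   cost of one extra [Sb <= rho * B + H], which is affordable because [rho < 1]. *)
Lemma series_bounds_incompatible (A B Sb Se E x rho H q : R) (N : nat) :
  let kappa := (1 - rho) / 8 in
  0 < rho < 1 -> 0 <= H -> 0 < x < 1 -> x ^ N = q -> 0 < q <= / 2 -> (2 <= N)%nat ->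
  0 <= A -> 0 < Sb -> 0 <= Se ->
  2 <= B -> 3 / kappa <= B -> 2 * (H + 1) / (1 - rho) < B ->
  Sb * Se <= kappa ^ 3 * q * B ^ 3 ->
  Sb <= rho * B + H ->
  (1 - x) * B ^ 2 <= Sb ->
  (1 - x) * E ^ 2 <= Se ->
  Rabs (A ^ 2 - B ^ 2 - (1 - x) * E) <= 1 ->
  (forall (M : nat) (tau : R), (1 <= M <= N)%nat -> 0 < tau ->
     rpeval (fun _ => 1) M x * A
     <= INR M * rpeval (fun _ => 1) M x * Sb + tau * rpeval (fun _ => 1) M x
        + Se / tau + 1) ->
  False.
Proof.
  intros kappa Hrho HH Hx HxN Hq HN HA HSb HSe HB2 HBk HBH HSS HSbB HCS HCE Hid Hmain.
  assert (Hk : 0 < kappa <= / 8) by (unfold kappa; lra).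
  assert (HBk3 : 3 <= kappa * B).
  { apply Rmult_le_reg_r with (/ kappa); [apply Rinv_0_lt_compat; lra|].
    replace (kappa * B * / kappa) with B by (field; lra). exact HBk. }
  assert (HBH' : 2 * (H + 1) < (1 - rho) * B).
  { apply Rmult_lt_reg_r with (/ (1 - rho)); [apply Rinv_0_lt_compat; lra|].
    replace ((1 - rho) * B * / (1 - rho)) with B by (field; lra). exact HBH. }
  assert (Hz : kappa ^ 3 * q <= 1).
  { assert (kappa ^ 3 <= 1) by (apply pow_le_1; lra).
    assert (0 <= kappa ^ 3) by (apply pow_le; lra). nra. }
  (* From [(1 - x) B ^ 2 Se <= Sb Se <= B ^ 3] one gets [(1 - x) Se <= B], hence
     [((1 - x) E) ^ 2 <= B]. So [A ^ 2] falls short of [B ^ 2] by at most [B + 2]. *)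
  assert (HlowA : (1 - kappa) * B <= A).
  { assert (H1 : (1 - x) * Se <= B).
    { apply Rmult_le_reg_r with (B ^ 2); [nra|].
      apply Rle_trans with (Sb * Se).
      - replace ((1 - x) * Se * B ^ 2) with ((1 - x) * B ^ 2 * Se) by ring.
        apply Rmult_le_compat_r; assumption.
      - replace (B * B ^ 2) with (1 * B ^ 3) by ring.
        eapply Rle_trans; [exact HSS|].
        apply Rmult_le_compat_r; [apply pow_le; lra | assumption]. }
    assert (H2 : ((1 - x) * E) ^ 2 <= B).
    { apply Rle_trans with ((1 - x) * Se); [|assumption].
      replace (((1 - x) * E) ^ 2) with ((1 - x) * ((1 - x) * E ^ 2)) by ring.
      apply Rmult_le_compat_l; [lra | assumption]. }
    assert (H3 : - B - 1 <= (1 - x) * E) by nra.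
    assert (H4 : B ^ 2 - B - 2 <= A ^ 2)
      by (unfold Rabs in Hid; destruct Rcase_abs; lra).
    assert (H5 : ((1 - kappa) * B) ^ 2 <= A ^ 2).
    { assert (3 * B <= kappa * B * B) by nra.
      assert (0 <= kappa * (1 - kappa) * B ^ 2)
        by (apply Rmult_le_pos; [nra | apply pow2_ge_0]).
      nra. }
    apply Rsqr_incr_0_var; [unfold Rsqr; lra | assumption]. }
  destruct (ceil_nat (kappa * B / Sb)) as [M [HM1 [HM2 HM3]]].
  { apply Rlt_le, Rdiv_lt_0_compat; [nra | assumption]. }
  assert (HNR : 2 <= INR N) by (change 2 with (INR 2); apply le_INR; assumption).
  (* [Sb >= (1 - x) B ^ 2] and [(1 - x) N >= 1 - q >= 1/2] give [kappa B / Sb <= N / 2]; rounding up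
     is absorbed by [N >= 2]. This keeps [x ^ M >= q]. *)
  assert (HMN : (M <= N)%nat).
  { apply INR_le. eapply Rle_trans; [exact HM3|].
    assert (Hgap : / 2 <= (1 - x) * INR N).
    { pose proof (geometric_rsum x N) as Hg. rewrite HxN in Hg.
      destruct (sub_geometric_bounds x N) as [_ [_ Hs]]; [lra | lia |].
      assert ((1 - x) * rpeval (fun _ => 1) N x <= (1 - x) * INR N)
        by (apply Rmult_le_compat_l; lra).
      lra. }
    assert (kappa * B / Sb <= INR N / 2).
    { apply Rmult_le_reg_r with Sb; [assumption|].
      replace (kappa * B / Sb * Sb) with (kappa * B) by (field; lra).
      apply Rle_trans with (INR N / 2 * ((1 - x) * B ^ 2)).
      - replace (INR N / 2 * ((1 - x) * B ^ 2))
          with ((1 - x) * INR N * (B / 2) * B) by field.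
        apply Rmult_le_compat_r; [lra|].
        assert (/ 2 * 1 <= (1 - x) * INR N * (B / 2)) by (apply Rmult_le_compat; lra).
        lra.
      - apply Rmult_le_compat_l; lra. }
    lra. }
  assert (HMS : kappa * B <= INR M * Sb <= kappa * B + Sb).
  { assert (E1 : kappa * B / Sb * Sb = kappa * B) by (field; lra).
    split.
    - rewrite <- E1. apply Rmult_le_compat_r; lra.
    - rewrite <- E1 at 1. replace (kappa * B / Sb * Sb + Sb)
        with ((kappa * B / Sb + 1) * Sb) by ring.
      apply Rmult_le_compat_r; lra. }
  (* With [tau = kappa B] both error terms, [tau P] and [Se / tau], are at most [kappa B P]. *)
  specialize (Hmain M (kappa * B) (conj HM1 HMN) ltac:(nra)).
  destruct (sub_geometric_bounds x M) as [HP1 [HPM _]]; [lra | assumption |].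
  revert Hmain HP1 HPM. generalize (rpeval (fun _ => 1) M x) as P.
  intros P Hmain HP1 HPM.
  assert (HPq : INR M * q <= P).
  { eapply Rle_trans; [|exact HPM]. apply Rmult_le_compat_l; [apply pos_INR|].
    rewrite <- HxN. apply pow_antitone; [lra | assumption]. }
  assert (HSe' : Se / (kappa * B) <= kappa * B * P).
  { apply Rmult_le_reg_r with (kappa * B * Sb); [nra|].
    replace (Se / (kappa * B) * (kappa * B * Sb)) with (Sb * Se) by (field; lra).
    eapply Rle_trans; [exact HSS|].
    apply Rle_trans with ((kappa * B) ^ 2 * q * (kappa * B)); [right; ring|].
    apply Rle_trans with ((kappa * B) ^ 2 * q * (INR M * Sb)).
    - apply Rmult_le_compat_l; [|lra]. apply Rmult_le_pos; [apply pow2_ge_0 | lra].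
    - replace ((kappa * B) ^ 2 * q * (INR M * Sb))
        with ((kappa * B) ^ 2 * Sb * (INR M * q)) by ring.
      replace (kappa * B * P * (kappa * B * Sb)) with ((kappa * B) ^ 2 * Sb * P) by ring.
      apply Rmult_le_compat_l; [|lra]. apply Rmult_le_pos; [apply pow2_ge_0 | lra]. }
  (* Dividing by [P] gives [(1 - kappa) B <= A <= 3 kappa B + rho B + H + 1]. As
     [4 kappa = (1 - rho) / 2], this means [(1 - rho) B <= 2 (H + 1)], against [HBH']. *)
  assert (Hfin : P * A <= P * (INR M * Sb + kappa * B + kappa * B + 1)) by nra.
  apply Rmult_le_reg_l in Hfin; [|lra].
  assert (8 * kappa = 1 - rho) by (unfold kappa; field).
  nra.
Qed.

(** The parameters are fixed in the order [p], [eta], [N], [r], [K]: the radius satisfies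
    [r ^ N = p], and the truncation degree [T = K N] comes last. *)
Lemma unbounded_case (a : nat -> nat) (b e : nat -> R) (C rho beta : R) (n0 : nat) :
  (forall n, (n0 <= n)%nat -> 0 < b n <= rho) -> 0 < rho < 1 ->
  (forall n, INR (a n) <= beta) -> (forall n, Rabs (b n) <= beta) ->
  1 <= C -> (forall n, (n0 <= n)%nat -> psum b (2 * n) <= C * psum b n) ->
  (forall X, exists n1, forall n, (n1 <= n)%nat -> X <= psum b n) ->
  (forall eta, 0 < eta -> exists n1, forall n, (n1 <= n)%nat ->
     psum (fun k => b k ^ 2) n * psum (fun k => e k ^ 2) n <= eta * psum b n ^ 3) ->
  (forall n, psum (conv (fun k => INR (a k))) n = psum (conv b) n + e n) ->
  False.
Proof.
  intros Hb Hrho Habeta Hbbeta HC Hdbl Hinf Hsmall Hid.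
  assert (HC3 : 1 <= C ^ 3) by (apply pow_R1_Rle; assumption).
  (* Then [p <= 1/16], as [cube_pow_le_1] asks, and [x ^ N C ^ 3 = p ^ 2 C ^ 3 = p / 16], as the
     block estimate asks. *)
  set (p := / (16 * C ^ 3)).
  assert (Hp : 0 < p <= / 16).
  { unfold p. split; [apply Rinv_0_lt_compat; lra|]. apply Rinv_le_contravar; lra. }
  assert (HpC : p * C ^ 3 = / 16) by (unfold p; field; lra).
  set (q := p ^ 2). set (kappa := (1 - rho) / 8).
  assert (Hk : 0 < kappa) by (unfold kappa; lra).
  assert (Hq : 0 < q <= / 2) by (unfold q; nra).
  set (H := rsum (fun n => Rabs (b n) + b n ^ 2) n0).
  set (H1 := rsum (fun n => Rabs (b n)) n0).
  assert (HH : 0 <= H).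
  { apply rsum_ge_0. intros. pose proof (Rabs_pos (b k)). pose proof (pow2_ge_0 (b k)). lra. }
  assert (HH1 : 0 <= H1) by (apply rsum_ge_0; intros; apply Rabs_pos).
  assert (Hb0 : forall n, (n0 <= n)%nat -> 0 <= b n) by (intros n Hn; specialize (Hb n Hn); lra).
  (* [X] dominates the three lower bounds required of [B]; the last [+ 1] makes the third strict. *)
  set (X := 2 + 3 / kappa + (2 * (H + 1) / (1 - rho) + 1)).
  assert (HX1 : 0 <= 3 / kappa) by (apply Rlt_le, Rdiv_lt_0_compat; lra).
  assert (HX2 : 0 <= 2 * (H + 1) / (1 - rho)) by (apply Rlt_le, Rdiv_lt_0_compat; lra).
  (* Chosen so that [4 eta S ^ 3 = kappa ^ 3 q (q S / 2) ^ 3] with [S = psum b N], where [q S / 2]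
     is a lower bound for [B]. *)
  set (eta := kappa ^ 3 * q * q ^ 3 / 32).
  assert (Hk3 : 0 < kappa ^ 3) by (apply pow_lt; assumption).
  assert (Hq3 : 0 < q ^ 3) by (apply pow_lt; lra).
  assert (Heta : 0 < eta).
  { unfold eta. apply Rdiv_lt_0_compat; [|lra].
    repeat apply Rmult_lt_0_compat; lra. }
  destruct (Hinf (2 * (X + H1) / q)) as [n1 Hn1].
  destruct (Hsmall eta Heta) as [n2 Hn2].
  set (N := (n0 + n1 + n2 + 2)%nat).
  assert (HyX : 2 * (X + H1) <= q * psum b N).
  { specialize (Hn1 N ltac:(unfold N; lia)).
    apply Rmult_le_reg_r with (/ q); [apply Rinv_0_lt_compat; lra|].
    replace (q * psum b N * / q) with (psum b N) by (field; lra). exact Hn1. }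
  destruct (exists_nth_root p N) as [r [Hr HrN]]; [lra | unfold N; lia |].
  set (x := r ^ 2).
  assert (Hx : 0 < x < 1) by (unfold x; nra).
  assert (HxN : x ^ N = q)
    by (unfold x, q; rewrite <- HrN, <- !pow_mult; f_equal; lia).
  (* [D N ^ 2] equals [4 beta ^ 2 N ^ 4 K ^ 2 p ^ K], so [K >= K0] bounds it by [K ^ 3 p ^ K <= 1];
     the [+ 2] in [K] ensures [N < T]. *)
  destruct (ceil_nat (4 * beta ^ 2 * INR N ^ 4)) as [K0 [_ [HK0 _]]].
  { apply Rmult_le_pos; [pose proof (pow2_ge_0 beta); lra | apply pow_le, pos_INR]. }
  set (K := (K0 + 2)%nat).
  set (T := (K * N)%nat).
  set (D := 4 * beta ^ 2 * INR T ^ 2 * r ^ T).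
  assert (HD : 0 <= D /\ D * INR N ^ 2 <= 1).
  { split.
    - apply Rmult_le_pos; [|apply pow_le; lra].
      apply Rmult_le_pos; [pose proof (pow2_ge_0 beta); lra | apply pow2_ge_0].
    - unfold D, T.
      replace (r ^ (K * N)) with (p ^ K) by (rewrite <- HrN, <- pow_mult; f_equal; lia).
      rewrite mult_INR.
      replace (4 * beta ^ 2 * (INR K * INR N) ^ 2 * p ^ K * INR N ^ 2)
        with (4 * beta ^ 2 * INR N ^ 4 * (INR K ^ 2 * p ^ K)) by ring.
      apply Rle_trans with (INR K * (INR K ^ 2 * p ^ K)).
      + apply Rmult_le_compat_r.
        * apply Rmult_le_pos; [apply pow2_ge_0 | apply pow_le; lra].
        * eapply Rle_trans; [exact HK0|]. apply le_INR. unfold K; lia.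
      + replace (INR K * (INR K ^ 2 * p ^ K)) with (INR K ^ 3 * p ^ K) by ring.
        apply cube_pow_le_1. lra. }
  assert (HT : (N < T)%nat) by (unfold T, K, N; nia).
  assert (Habs : forall n, Rabs (INR (a n)) <= beta)
    by (intros n; rewrite Rabs_pos_eq; [apply Habeta | apply pos_INR]).
  assert (HNN : 1 <= INR N) by (change 1 with (INR 1); apply le_INR; unfold N; lia).
  assert (HBlow : q / 2 * psum b N <= rpeval b T x /\ X <= rpeval b T x).
  { pose proof (power_series_lower_bound b x n0 N T Hb0 ltac:(lra) ltac:(unfold N; lia) HT)
      as HL.
    rewrite HxN in HL. fold H1 in HL. unfold X in *. split; lra. }
  destruct HBlow as [HBlow HBX].
  apply (series_bounds_incompatible
    (rpeval (fun n => INR (a n)) T x) (rpeval b T x)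
    (rpeval (fun n => b n ^ 2) T x) (rpeval (fun n => e n ^ 2) T x)
    (rpeval e T x) x rho H q N);
    try assumption; fold kappa; try (unfold X in HBX; lra).
  - unfold N; lia.
  - apply rsum_ge_0. intros. apply Rmult_le_pos; [apply pos_INR | apply pow_le; lra].
  - pose proof (power_series_cauchy_schwarz b r T ltac:(lra)) as HCS. fold x in HCS.
    eapply Rlt_le_trans; [|exact HCS]. apply Rmult_lt_0_compat; [lra|].
    apply pow_lt. unfold X in HBX. lra.
  - apply rsum_ge_0. intros. apply Rmult_le_pos; [apply pow2_ge_0 | apply pow_le; lra].
  - assert (HbN : 0 <= psum b N) by (unfold X in HyX; nra).
    eapply Rle_trans.
    { unfold T. apply power_series_product_bound with (b := b) (C := C) (eta := eta) (n0 := n0);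
        try assumption; try lra.
      - intros; apply pow2_ge_0.
      - intros; apply pow2_ge_0.
      - unfold N; lia.
      - unfold N; lia.
      - intros n Hn. apply Hn2. unfold N in Hn; lia.
      - rewrite HxN. unfold q. replace (p ^ 2 * C ^ 3) with (p * (p * C ^ 3)) by ring.
        rewrite HpC. lra. }
    replace (4 * (eta * psum b N ^ 3)) with (kappa ^ 3 * q * (q / 2 * psum b N) ^ 3)
      by (unfold eta; field).
    apply Rmult_le_compat_l; [nra|]. apply pow_incr. split; [nra | assumption].
  - apply power_series_square_bound; try lra.
    intros n Hn. specialize (Hb n Hn). lra.
  - apply power_series_cauchy_schwarz. lra.
  - apply power_series_cauchy_schwarz. lra.
  - assert (Hxm : Cmod (RtoC x) = x) by (rewrite Cmod_R; apply Rabs_pos_eq; lra).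
    pose proof (truncated_identity (fun n => INR (a n)) b e beta (RtoC x) T
                 Habs Hbbeta Hid ltac:(lra) ltac:(lia)) as HI.
    rewrite Hxm, !peval_RtoC, <- !RtoC_pow, <- !RtoC_minus, <- RtoC_mult, <- RtoC_minus,
      Cmod_R in HI.
    eapply Rle_trans; [exact HI|].
    (* As [x = r ^ 2 <= r], the error bound for the circle of radius [r] also covers the point
       [x]. *)
    apply Rle_trans with D.
    + apply Rmult_le_compat_l.
      * apply Rmult_le_pos; [pose proof (pow2_ge_0 beta); lra | apply pow2_ge_0].
      * apply pow_incr. unfold x. nra.
    + assert (1 <= INR N ^ 2) by nra. nra.
  - intros M tau HM Htau.
    eapply Rle_trans.
    + apply averaged_inequality with (b := b) (e := e) (tau := tau) (D := D);
        [lia | lra | assumption |].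
      intros u Hu. unfold D. rewrite <- Hu.
      apply truncated_identity; try assumption; [lra | lia].
    + fold x. apply Rplus_le_compat_l.
      apply Rle_trans with (D * INR N ^ 2); [|lra].
      apply Rmult_le_compat_l; [lra|]. apply pow_incr. split; [apply pos_INR|].
      apply le_INR; lia.
Qed.

(** * The case of a bounded mass [psum b] *)

Lemma rsum_rev (f : nat -> R) n : rsum f (S n) = rsum (fun k => f (n - k)%nat) (S n).
Proof.
  induction n as [|n IH]; [reflexivity|].
  change (rsum f (S (S n))) with (rsum f (S n) + f (S n)).
  change (S (S n)) with (1 + S n)%nat. rewrite rsum_add, IH.
  cbn [rsum]. rewrite Nat.sub_0_r. simpl. ring.
Qed.

Lemma rsum_single (f : nat -> R) i n :
  (i < n)%nat -> (forall k, (k < n)%nat -> k <> i -> f k = 0) -> rsum f n = f i.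
Proof.
  induction n as [|n IH]; intros Hi Hf; [lia|]. cbn [rsum].
  destruct (Nat.eq_dec i n) as [->|Hne].
  - rewrite (rsum_ext f (fun _ => 0)) by (intros; apply Hf; lia).
    rewrite rsum_const. ring.
  - rewrite IH, (Hf n) by (lia || (intros; apply Hf; lia)). ring.
Qed.

Lemma least_index (P : nat -> Prop) :
  (exists n, P n) -> exists n, P n /\ forall k, (k < n)%nat -> ~ P k.
Proof.
  intros [n Hn]. apply NNPP. intros Hno.
  assert (Hall : forall m k, (k < m)%nat -> ~ P k).
  { induction m as [|m IH]; intros k Hk HP; [lia|].
    apply Hno. exists k. split; [assumption|]. intros i Hi. apply IH. lia. }
  exact (Hall (S n) n (Nat.lt_succ_diag_r n) Hn).
Qed.

(* With [d = a - b] and [s = a + b] the Cauchy product of [d] and [s] vanishes, but its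
   lowest coefficient is the product of those of [d] and [s]. *)
Lemma conv_eq_sign (a b : nat -> R) :
  (forall n, conv a n = conv b n) ->
  (forall n, a n = b n) \/ (forall n, a n = - b n).
Proof.
  intros Hconv. apply NNPP. intros Hno. apply not_or_and in Hno.
  destruct Hno as [H1 H2].
  apply not_all_ex_not, least_index in H1. apply not_all_ex_not, least_index in H2.
  destruct H1 as [i [Hi Hi']], H2 as [j [Hj Hj']].
  set (n := (i + j)%nat).
  assert (E0 : rsum (fun k => (a k - b k) * (a (n - k)%nat + b (n - k)%nat)) (S n) = 0).
  (* The squares cancel by [Hconv], the mixed sums by reversing the order of one of them. *)
  { pose proof (Hconv n) as Hn. rewrite !conv_rsum in Hn.
    pose proof (rsum_rev (fun k => b k * a (n - k)%nat) n) as Hrev.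
    transitivity (rsum (fun k => a k * a (n - k)%nat) (S n)
                  + (-1) * rsum (fun k => b k * b (n - k)%nat) (S n)
                  + (rsum (fun k => a k * b (n - k)%nat) (S n)
                     + (-1) * rsum (fun k => b k * a (n - k)%nat) (S n))).
    - rewrite <- !rsum_scal, <- !rsum_plus. apply rsum_ext. intros; ring.
    - rewrite Hn, Hrev.
      rewrite (rsum_ext (fun k => b (n - k)%nat * a (n - (n - k))%nat)
                        (fun k => a k * b (n - k)%nat)).
      + ring.
      + intros k Hk. replace (n - (n - k))%nat with k by lia. ring. }
  rewrite (rsum_single _ i) in E0.
  - replace (n - i)%nat with j in E0 by (unfold n; lia).
    apply Rmult_integral in E0. destruct E0; [apply Hi | apply Hj]; lra.
  - unfold n; lia.
  - intros k Hk Hki. destruct (Nat.lt_ge_cases k i) as [Hlt|Hge].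
    + specialize (Hi' k Hlt). apply NNPP in Hi'. rewrite Hi'. ring.
    + assert (Hlt : (n - k < j)%nat) by (unfold n in *; lia).
      specialize (Hj' _ Hlt). apply NNPP in Hj'. rewrite Hj'. ring.
Qed.

Lemma psum_ge_term (f : nat -> R) m n :
  (forall k, 0 <= f k) -> (m <= n)%nat -> f m <= psum f n.
Proof.
  intros Hf Hmn. rewrite psum_rsum.
  apply Rle_trans with (rsum f (S m)); [|apply rsum_monotone; [lia | auto]].
  cbn [rsum]. assert (0 <= rsum f m) by (apply rsum_ge_0; auto). lra.
Qed.

(** If [e m] were nonzero, the numerator would stay above [b n0 ^ 2 * e m ^ 2 > 0] while the
    denominator stays bounded, so the quotient could not tend to [0]. *)
Lemma bounded_mass_error_zero (b e : nat -> R) (U : R) (n0 : nat) :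
  (forall n, (n0 <= n)%nat -> 0 < b n) ->
  (forall n, (n0 <= n)%nat -> psum b n <= U) ->
  is_lim_seq (fun n => psum (fun k => b k ^ 2) n * psum (fun k => e k ^ 2) n
                       / (psum b n) ^ 3) 0 ->
  forall m, e m = 0.
Proof.
  intros Hb HU Hlim m. apply NNPP. intros Hm.
  set (c := b n0 ^ 2 * e m ^ 2).
  assert (Hc : 0 < c).
  { apply Rmult_lt_0_compat; [apply pow_lt, Hb; lia|].
    rewrite <- Rsqr_pow2. apply Rsqr_pos_lt; assumption. }
  set (V := Rabs (psum b n0) + Rabs U).
  assert (HV : 0 <= V ^ 3)
    by (apply pow_le; unfold V; pose proof (Rabs_pos (psum b n0)); pose proof (Rabs_pos U); lra).
  assert (Heps : 0 < c / (V ^ 3 + 1)) by (apply Rdiv_lt_0_compat; lra).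
  apply is_lim_seq_spec in Hlim. destruct (Hlim (mkposreal _ Heps)) as [n1 Hn1].
  cbn [pos] in Hn1.
  (* The quotient is informative only at a nonzero denominator. Past [n0] the partial sums increase
     strictly, so two consecutive ones cannot both vanish. *)
  assert (Hn : exists n, (n0 + m + n1 <= n)%nat /\ psum b n <> 0).
  { set (n := (n0 + m + n1)%nat).
    destruct (Req_dec (psum b n) 0) as [E|E]; [|exists n; split; [lia | assumption]].
    exists (S n). split; [lia|].
    unfold psum in *. simpl. rewrite E. specialize (Hb (S n) ltac:(unfold n; lia)). lra. }
  destruct Hn as [n [Hn HBn]].
  specialize (Hn1 n ltac:(lia)). rewrite Rminus_0_r in Hn1.
  set (num := psum (fun k => b k ^ 2) n * psum (fun k => e k ^ 2) n) in *.
  assert (Hnum : c <= num).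
  { apply Rmult_le_compat; try apply pow2_ge_0.
    - apply (psum_ge_term (fun k => b k ^ 2)); [intros; apply pow2_ge_0 | lia].
    - apply (psum_ge_term (fun k => e k ^ 2)); [intros; apply pow2_ge_0 | lia]. }
  assert (HB : Rabs (psum b n) ^ 3 <= V ^ 3).
  { apply pow_incr. split; [apply Rabs_pos|].
    assert (psum b n0 <= psum b n).
    { apply psum_monotone with n0; [|lia|lia]. intros k Hk. apply Rlt_le, Hb, Hk. }
    specialize (HU n ltac:(lia)). unfold V.
    unfold Rabs. repeat destruct Rcase_abs; lra. }
  assert (HBpos : 0 < Rabs (psum b n) ^ 3) by (apply pow_lt, Rabs_pos_lt; assumption).
  rewrite Rabs_div, <- RPow_abs, (Rabs_pos_eq num) in Hn1
    by (lra || (apply pow_nonzero; assumption)).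
  apply (Rmult_lt_compat_r (Rabs (psum b n) ^ 3)) in Hn1; [|assumption].
  replace (num / Rabs (psum b n) ^ 3 * Rabs (psum b n) ^ 3) with num in Hn1
    by (field; apply Rabs_no_R0; assumption).
  assert (c / (V ^ 3 + 1) * Rabs (psum b n) ^ 3 <= c / (V ^ 3 + 1) * (V ^ 3 + 1))
    by (apply Rmult_le_compat_l; lra).
  replace (c / (V ^ 3 + 1) * (V ^ 3 + 1)) with c in H by (field; lra).
  lra.
Qed.

(** * Unpacking the limit hypotheses and assembling the two cases *)

Lemma psum_inj (f g : nat -> R) :
  (forall n, psum f n = psum g n) -> forall n, f n = g n.
Proof.
  intros H [|n]; [exact (H O)|].
  pose proof (H n) as H1. pose proof (H (S n)) as H2. unfold psum in *. simpl in H2. lra.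
Qed.

(** The midpoint between the limit superior and [l] serves as [rho]; when the limit superior is
    minus infinity, [l - 1] does. *)
Lemma LimSup_lt_eventually (u : nat -> R) (l : R) :
  Rbar_lt (LimSup_seq u) (Finite l) ->
  exists rho, rho < l /\ exists n0, forall n, (n0 <= n)%nat -> u n <= rho.
Proof.
  unfold LimSup_seq. destruct (ex_LimSup_seq u) as [[s| |] Hs]; simpl; intros Hl.
  - assert (Heps : 0 < (l - s) / 2) by lra.
    destruct (Hs (mkposreal _ Heps)) as [_ [n0 Hn0]]. simpl in Hn0.
    exists (s + (l - s) / 2). split; [lra|]. exists n0. intros n Hn.
    apply Rlt_le, Hn0, Hn.
  - contradiction.
  - destruct (Hs (l - 1)) as [n0 Hn0]. exists (l - 1). split; [lra|].
    exists n0. intros n Hn. apply Rlt_le, Hn0, Hn.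
Qed.

Theorem theorem3 (b e : nat -> R) :
  (exists n0 : nat, forall n, (n0 <= n)%nat -> 0 < b n) ->
  (exists C : R, exists n0 : nat, forall n, (n0 <= n)%nat ->
       psum b (2 * n) / psum b n < C) ->
  Rbar_lt (LimSup_seq b) (Finite 1) ->
  is_lim_seq (fun n => psum (fun k => b k ^ 2) n * psum (fun k => e k ^ 2) n
                       / (psum b n) ^ 3) 0 ->
  ~ (exists A : nat -> bool, forall N : nat,
        psum (RA A) N = psum (conv b) N + e N).
Proof.
  intros [n1 Hpos] [C [n2 Hdbl]] Hsup Hlim [A HA].
  apply LimSup_lt_eventually in Hsup. destruct Hsup as [rho [Hrho [n3 Hle]]].
  assert (Hrho0 : 0 < rho).
  { specialize (Hpos (n1 + n3)%nat ltac:(lia)). specialize (Hle (n1 + n3)%nat ltac:(lia)). lra. }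
  change (forall n, psum (conv (chi A)) n = psum (conv b) n + e n) in HA.
  destruct (classic (exists U, forall n, (n1 <= n)%nat -> psum b n <= U)) as [[U HU]|Hunb].
  - pose proof (bounded_mass_error_zero b e U n1 Hpos HU Hlim) as He.
    assert (Hc : forall n, conv (chi A) n = conv b n)
      by (apply psum_inj; intros n; rewrite HA, He; ring).
    set (n := (n1 + n3)%nat).
    specialize (Hpos n ltac:(unfold n; lia)). specialize (Hle n ltac:(unfold n; lia)).
    (* [chi A n] is [0] or [1], whereas [0 < b n <= rho < 1]. *)
    destruct (conv_eq_sign _ _ Hc) as [E|E]; specialize (E n); unfold chi in E;
      destruct (A n); lra.
  - assert (Hinf : forall X, exists m, forall n, (m <= n)%nat -> X <= psum b n).
    { intros X. apply NNPP. intros Hno. apply Hunb. exists X. intros n Hn.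
      apply Rnot_lt_le. intros Hlt. apply Hno. exists n. intros k Hk.
      apply Rle_trans with (psum b n); [lra|].
      apply psum_monotone with n1; [|assumption|assumption].
      intros i Hi. apply Rlt_le, Hpos, Hi. }
    (* Past [n4] the mass is at least [1], so the quotients in the doubling and limit hypotheses can
       be cleared. *)
    destruct (Hinf 1) as [n4 Hone].
    set (n0 := (n1 + n2 + n3 + n4)%nat).
    (* A common bound for both sequences: the [1] covers [chi A] and [b] from [n0] on, the sum
       covers the initial terms of [b]. *)
    set (beta := 1 + rsum (fun k => Rabs (b k)) n0).
    assert (Hsum : 0 <= rsum (fun k => Rabs (b k)) n0)
      by (apply rsum_ge_0; intros; apply Rabs_pos).
    set (a := fun n => if A n then 1%nat else 0%nat).
    assert (Ha : (fun k => INR (a k)) = chi A).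
    { apply functional_extensionality. intros k. unfold a, chi. destruct (A k); reflexivity. }
    apply (unbounded_case a b e (Rmax 1 C) rho beta n0).
    + intros n Hn. split; [apply Hpos | apply Hle]; unfold n0 in Hn; lia.
    + lra.
    + intros n. unfold a, beta. destruct (A n); simpl; lra.
    + intros n. destruct (Nat.lt_ge_cases n n0) as [Hn|Hn].
      * apply Rle_trans with (psum (fun k => Rabs (b k)) n).
        -- apply (psum_ge_term (fun k => Rabs (b k))); [intros; apply Rabs_pos | lia].
        -- rewrite psum_rsum.
           apply Rle_trans with (rsum (fun k => Rabs (b k)) n0); [|unfold beta; lra].
           apply rsum_monotone; [lia | intros; apply Rabs_pos].
      * specialize (Hpos n ltac:(unfold n0 in Hn; lia)).
        specialize (Hle n ltac:(unfold n0 in Hn; lia)).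
        rewrite Rabs_pos_eq by lra. unfold beta. lra.
    + apply Rmax_l.
    + intros n Hn. specialize (Hdbl n ltac:(unfold n0 in Hn; lia)).
      specialize (Hone n ltac:(unfold n0 in Hn; lia)).
      apply (Rmult_lt_compat_r (psum b n)) in Hdbl; [|lra].
      replace (psum b (2 * n) / psum b n * psum b n) with (psum b (2 * n)) in Hdbl
        by (field; lra).
      pose proof (Rmax_r 1 C). nra.
    + exact Hinf.
    + intros eta Heta. apply is_lim_seq_spec in Hlim.
      destruct (Hlim (mkposreal _ Heta)) as [m Hm]. cbn [pos] in Hm.
      exists (m + n0)%nat. intros n Hn. specialize (Hm n ltac:(lia)).
      specialize (Hone n ltac:(unfold n0 in Hn; lia)).
      rewrite Rminus_0_r in Hm. apply Rabs_def2 in Hm. destruct Hm as [Hm _].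
      assert (Hcube : 0 < psum b n ^ 3) by (apply pow_lt; lra).
      apply (Rmult_lt_compat_r (psum b n ^ 3)) in Hm; [|assumption].
      match type of Hm with ?u / ?v * ?v < _ =>
        replace (u / v * v) with u in Hm by (field; lra) end.
      lra.
    + rewrite Ha. exact HA.
Qed.
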